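(* Let $r$ be a proper tensor rank function and let $\bar r$ be its closure. Then $\bar r$ is also a proper tensor rank function, and $\bar r\le r$ (i.e. $\bar r(\mathcal{X})\le r(\mathcal{X})$ for all $\mathcal{X}\in\mathbf{T}$). Moreover, a proper tensor rank function $r$ has the max-full-rank-subtensor property if and only if $\bar r=r$.
   Context: $\mathbf{Z}_+$ is the set of nonnegative integers and $\mathbf{N}$ the set of positive integers. For $m,n_1,\dots,n_m\in\mathbf{N}$, $\mathbf{T}(n_1,\dots,n_m)$ is the set of real $m$th order tensors $\mathcal{X}=(x_{i_1\cdots i_m})$ of dimension $n_1\times\cdots\times n_m$; $\mathbf{CT}(m,n)$ is the case $n_1=\cdots=n_m=n$; $\mathbf{T}$ is the set of all real tensors (all orders $m\ge1$, all dimensions). A tensor $\mathcal{X}\in\mathbf{T}(n_1,\dots,n_m)$ is rank-one if $\mathcal{X}=\mathbf{x}^{(1)}\circ\cdots\circ\mathbf{x}^{(m)}$ (outer product) with nonzero $\mathbf{x}^{(i)}\in\mathbb{R}^{n_i}$. The identity tensor $\mathcal{I}_{m,n}\in\mathbf{CT}(m,n)$ has entries $1$ when $i_1=\cdots=i_m$ and $0$ otherwise. A subtensor of $\mathcal{X}\in\mathbf{T}(n_1,\dots,n_m)$ is a tensor of the same order $m$ obtained by choosing nonempty index sets $T_l\subseteq\{1,\dots,n_l\}$, $l=1,\dots,m$, and restricting $\mathcal{X}$ to $T_1\times\cdots\times T_m$; it is an element of $\mathbf{T}(|T_1|,\dots,|T_m|)$. A function $r:\mathbf{T}\to\mathbf{Z}_+$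 is a tensor rank function if: (1) $r(\mathcal{X})=0$ iff $\mathcal{X}$ is a zero tensor, and $r(\mathcal{X})=1$ iff $\mathcal{X}$ is a rank-one tensor; (2) $r(\mathcal{I}_{m,n})=n$ for all $m,n\in\mathbf{N}$ with $m\ge2$; (3) for $\mathcal{X}\in\mathbf{T}(n_1,n_2,1,\dots,1)$ (order at least $2$), $r(\mathcal{X})$ equals the matrix rank of the $n_1\times n_2$ matrix corresponding to $\mathcal{X}$; (4) $r(\alpha\mathcal{X})=r(\mathcal{X})$ for every tensor $\mathcal{X}$ and real $\alpha\ne0$; (5) $r(\mathcal{Y})=r(\mathcal{X})$ whenever $\mathcal{Y}$ is obtained from $\mathcal{X}$ by permuting its modes, i.e. $\sigma$ is a permutation of the $m$ coordinates, $\mathcal{Y}$ has dimensions $\sigma(n_1,\dots,n_m)$, and the entry of $\mathcal{Y}$ at position $\sigma(i_1,\dots,i_m)$ is $x_{i_1\cdots i_m}$; (6) $r(\mathcal{Y})\le r(\mathcal{X})$ whenever $\mathcal{Y}$ is a subtensor of $\mathcal{X}$. A tensor rank function $r$ is proper if $r(\mathcal{X})\le n$ for all $m,n\in\mathbf{N}$ and $\mathcal{X}\in\mathbf{CT}(m,n)$. Full rank: for a tensor rank function $r$, a tensor $\mathcal{X}\in\mathbf{T}(n_1,\dots,n_m)$ is of full $r$ rank if $r(\mathcal{X})=n_p$ for some index $p$ with $1\le p\le m$; in addition, zero tensors are regarded as being of full $r$ rank. A subtensor $\mathcal{Y}$ of $\mathcal{X}$ is a maximum full rank subtensor of $\mathcal{X}$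 under $r$ if $\mathcal{Y}$ is of full $r$ rank and $r(\mathcal{Y})$ is the maximum of $r$ over all subtensors of $\mathcal{X}$ that are of full $r$ rank. The function $r$ has the max-full-rank-subtensor property if for every $\mathcal{X}\in\mathbf{T}$, $r(\mathcal{X})=r(\mathcal{Y})$ where $\mathcal{Y}$ is a maximum full rank subtensor of $\mathcal{X}$ under $r$. The closure $\bar r:\mathbf{T}\to\mathbf{Z}_+$ of a proper tensor rank function $r$ is defined by $\bar r(\mathcal{X})=\max\{r(\mathcal{Y}):\mathcal{Y}\text{ is a subtensor of }\mathcal{X}\text{ and is of full }r\text{ rank}\}$. *)

(* Defs.v *)
From mathcomp Require Import all_boot all_order all_fingroup all_algebra.
From mathcomp Require Import boolp reals.

Set Implicit Arguments.
Unset Strict Implicit.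
Unset Printing Implicit Defensive.

Import Order.TTheory GRing.Theory Num.Theory.
Local Open Scope ring_scope.

(* The set of all real tensors, of any order m >= 1 and any dimensions
   n_1 x ... x n_m with n_k >= 1.  Indices start from 0, and a multi-index is a
   dependent function k |-> i_k with i_k : 'I_(n_k). *)
Record tensor (R : realType) : Type := Tensor {
  tensor_order : nat;
  tensor_order_gt0 : (0 < tensor_order)%N;
  tensor_dim : 'I_tensor_order -> nat;
  tensor_dim_gt0 : forall k, (0 < tensor_dim k)%N;
  tensor_entry : (forall k, 'I_(tensor_dim k)) -> R
}.
Arguments tensor_dim {R} t k.
Arguments tensor_dim_gt0 {R} t k.
Arguments tensor_entry {R} t i.

Definition zero_tensor (R : realType) (X : tensor R) : Prop :=
  forall i, tensor_entry X i = 0.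

Definition rank_one (R : realType) (X : tensor R) : Prop :=
  exists x : forall k : 'I_(tensor_order X), 'rV[R]_(tensor_dim X k),
    (forall k, x k != 0) /\
    forall i, tensor_entry X i = \prod_(k < tensor_order X) x k 0 (i k).

Definition identity_tensor (R : realType) (m n : nat)
    (m_gt0 : (0 < m)%N) (n_gt0 : (0 < n)%N) : tensor R :=
  Tensor m_gt0 (fun _ : 'I_m => n_gt0)
    (fun i => if [forall k, forall l, i k == i l] then 1 else 0).

Definition scale_tensor (R : realType) (a : R) (X : tensor R) : tensor R :=
  Tensor (tensor_order_gt0 X) (tensor_dim_gt0 X) (fun i => a * tensor_entry X i).

(* Y is X with its modes permuted: mode k of Y is mode s k of X.  Since
   i |-> i \o s is a bijection on multi-indices, the equation on entries
   determines Y. *)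
Definition mode_permutation (R : realType) (X Y : tensor R) : Prop :=
  exists (s : 'S_(tensor_order X)) (y : (forall k, 'I_(tensor_dim X (s k))) -> R),
    (forall i : (forall k, 'I_(tensor_dim X k)),
       y (fun k => i (s k)) = tensor_entry X i) /\
    Y = Tensor (tensor_order_gt0 X) (fun k => tensor_dim_gt0 X (s k)) y.

Notation index_set n := {A : {set 'I_n} | (0 < #|A|)%N}.

(* On ordinals, enum_val lists the elements of a set in increasing order. *)
Definition subtensor (R : realType) (X : tensor R)
    (S : forall k, index_set (tensor_dim X k)) : tensor R :=
  @Tensor R (tensor_order X) (tensor_order_gt0 X)
    (fun k => #|val (S k)|) (fun k => valP (S k))
    (fun j => tensor_entry X (fun k => enum_val (j k))).

Definition is_subtensor (R : realType) (Y X : tensor R) : Prop :=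
  exists S : (forall k, index_set (tensor_dim X k)), Y = subtensor S.

Record tensor_rank_function (R : realType) (r : tensor R -> nat) : Prop := {
  rank_eq0 : forall X, r X = 0%N <-> zero_tensor X;
  rank_eq1 : forall X, r X = 1%N <-> rank_one X;
  rank_identity : forall (m n : nat) (m_gt0 : (0 < m)%N) (n_gt0 : (0 < n)%N),
    (2 <= m)%N -> r (identity_tensor R m_gt0 n_gt0) = n;
  (* A is the n_1 x n_2 matrix corresponding to X in T(n_1, n_2, 1, ..., 1);
     k1 and k2 are the first two modes of X. *)
  rank_matrix : forall (X : tensor R) (k1 k2 : 'I_(tensor_order X))
      (A : 'M[R]_(tensor_dim X k1, tensor_dim X k2)),
    nat_of_ord k1 = 0%N -> nat_of_ord k2 = 1%N ->
    (forall k : 'I_(tensor_order X), (2 <= k)%N -> tensor_dim X k = 1%N) ->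
    (forall i, tensor_entry X i = A (i k1) (i k2)) ->
    r X = \rank A;
  rank_scale : forall (a : R) X, a != 0 -> r (scale_tensor a X) = r X;
  rank_mode_permutation : forall X Y, mode_permutation X Y -> r Y = r X;
  rank_subtensor : forall X Y, is_subtensor Y X -> (r Y <= r X)%N
}.

Definition proper_tensor_rank_function (R : realType) (r : tensor R -> nat) :
    Prop :=
  tensor_rank_function r /\
  forall (X : tensor R) (n : nat), (forall k, tensor_dim X k = n) -> (r X <= n)%N.

Definition full_rank (R : realType) (r : tensor R -> nat) (X : tensor R) :
    Prop :=
  zero_tensor X \/ exists p, r X = tensor_dim X p.

Definition max_full_rank_subtensor (R : realType) (r : tensor R -> nat)
    (Y X : tensor R) : Prop :=
  [/\ is_subtensor Y X, full_rank r Y &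
      forall Z, is_subtensor Z X -> full_rank r Z -> (r Z <= r Y)%N].

Definition max_full_rank_subtensor_property (R : realType)
    (r : tensor R -> nat) : Prop :=
  forall X, exists Y, max_full_rank_subtensor r Y X /\ r X = r Y.

(* For a tensor rank function r the range of the maximum is never empty: X is
   zero, or it has a nonzero 1 x ... x 1 subtensor, which is of full rank. *)
Definition rank_closure (R : realType) (r : tensor R -> nat) (X : tensor R) :
    nat :=
  \max_(S : {dffun forall k : 'I_(tensor_order X), index_set (tensor_dim X k)}
         | `[< full_rank r (subtensor S) >]) r (subtensor S).

(* Main.v *)
(* Only the conditions "r-bar = 1 iff rank one" and the agreement with matrix
   rank need more than the monotonicity of r under subtensors.  For the matrix
   condition, a matrix of rank k has an invertible k x k submatrix.  For the
   other, fix a nonzero entry x_a.  A tensor X is rank one iff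
     x_i * x_a^(m-1) = prod_k x_(a with a_k replaced by i_k)   for every i.
   If this fails at some i, it already fails in the subtensor with index sets
   {a_k, i_k}, whose dimensions are at most 2.  Since r is proper and every
   tensor is a subtensor of a cubical one with the same largest dimension, r of
   that subtensor is exactly 2, so it is of full rank. *)
Require Import Defs.
From mathcomp Require Import all_boot all_order all_fingroup all_algebra.
From mathcomp Require Import boolp reals.

Set Implicit Arguments.
Unset Strict Implicit.
Unset Printing Implicit Defensive.

Import GRing.Theory.

(** * Increasing enumeration of sets of ordinals *)

Section EnumOrdinalSets.

Lemma sorted_enum_ord_set n (A : {set 'I_n}) : sorted ltn (map val (enum A)).
Proof.
rewrite sorted_map {1}/enum_mem; apply: sorted_filter.
  by move=> y x z; exact: ltn_trans.
by rewrite -sorted_map -enumT val_enum_ord iota_ltn_sorted.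
Qed.

Lemma enum_val_homo n (A : {set 'I_n}) :
  {homo (@enum_val _ (mem A)) : i j / (i < j)%N}.
Proof.
move=> i j ij; have x0 := enum_val i.
have sz (k : 'I_#|A|) : k < size (enum A) by rewrite -cardE.
rewrite !(enum_val_nth x0) -!(nth_map x0 0 val) ?sz //.
apply: (sorted_ltn_nth ltn_trans 0 (sorted_enum_ord_set A)) => //;
  by rewrite inE size_map sz.
Qed.

(** Mapping [f] over the increasing list of [A] gives a sorted list with the elements of [f @: A],
    hence its enumeration. The positions live in different ordinal types, so they are compared in
    nat. *)
Lemma enum_val_imset d n (f : 'I_d -> 'I_n) (A : {set 'I_d})
    (i : 'I_#|f @: A|) (j : 'I_#|A|) :
  {homo f : i j / (i < j)%N} -> i = j :> nat -> enum_val i = f (enum_val j).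
Proof.
move=> fhomo ij.
have finj : injective f.
  move=> x y fxy; apply: val_inj.
  by case: (ltngtP (val x) (val y)) => // /fhomo; rewrite fxy ltnn.
have ltn_f : {mono f : x y / (x < y)%N}.
  move=> x y; apply/idP/idP => [|/fhomo//]; apply: contraTT.
  rewrite -!leqNgt leq_eqVlt => /orP[/eqP/val_inj ->//|/fhomo/ltnW//].
have enumf : enum (f @: A) = map f (enum A).
  apply: (inj_map val_inj).
  apply: (irr_sorted_eq ltn_trans ltnn); first exact: sorted_enum_ord_set.
    rewrite -map_comp sorted_map.
    rewrite (eq_sorted (e' := relpre val ltn)); last exact: ltn_f.
    by rewrite -sorted_map sorted_enum_ord_set.
  move=> x; apply: eq_mem_map => y; rewrite mem_enum.
  by apply/imsetP/mapP => -[z zA ->]; exists z; rewrite ?mem_enum // -mem_enum.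
rewrite (enum_val_nth (enum_val i)) (enum_val_nth (enum_val j)) enumf ij.
by rewrite (nth_map (enum_val j)) // -cardE.
Qed.

Lemma enum_val_setT n (i : 'I_#|[set: 'I_n]|) : enum_val i = i :> nat.
Proof.
have ilt : i < n by move: (ltn_ord i); rewrite [X in _ < X]cardsT card_ord.
rewrite (enum_val_nth (enum_val i)) enum_setT -enumT.
by rewrite -[LHS](nth_map _ 0) ?val_enum_ord ?nth_iota // size_enum_ord.
Qed.

End EnumOrdinalSets.

(* Equality up to casts between index types: multi-indices are compared by
   their values in nat. *)
Lemma tensor_eq (R : realType) m (m0 m0' : (0 < m)%N) (d d' : 'I_m -> nat)
    (d0 : forall k, (0 < d k)%N) (d0' : forall k, (0 < d' k)%N)
    (x : (forall k, 'I_(d k)) -> R) (x' : (forall k, 'I_(d' k)) -> R) :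
  (forall k, d k = d' k) ->
  (forall (i : forall k, 'I_(d k)) (i' : forall k, 'I_(d' k)),
    (forall k, i k = i' k :> nat) -> x i = x' i') ->
  Tensor m0 d0 x = Tensor m0' d0' x'.
Proof.
move=> /funext dd'; case: _ / dd' in d0' x' * => xx'.
rewrite (Prop_irrelevance m0 m0') (Prop_irrelevance d0 d0').
by congr Tensor; apply: funext => i; exact: xx'.
Qed.

(** * Subtensors, cubical extensions and mode permutations *)

Section Subtensors.
Variable R : realType.
Implicit Types X Y Z : tensor R.

Lemma eq_tensor_entry X (i j : forall k, 'I_(tensor_dim X k)) :
  (forall k, i k = j k) -> tensor_entry X i = tensor_entry X j.
Proof.
by move=> ij; congr tensor_entry; exact: functional_extensionality_dep.
Qed.

Lemma card_setT_gt0 n : (0 < n)%N -> (0 < #|[set: 'I_n]|)%N.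
Proof. by rewrite cardsT card_ord. Qed.

Definition full_set n (n0 : (0 < n)%N) : index_set n :=
  exist _ [set: 'I_n] (card_setT_gt0 n0).

Lemma is_subtensor_refl X : is_subtensor X X.
Proof.
exists (fun k => full_set (tensor_dim_gt0 X k)).
case: X => m m0 d d0 x; apply: tensor_eq => [k|i i' ii'] /=.
  by rewrite cardsT card_ord.
congr x; apply: functional_extensionality_dep => k; apply: val_inj.
by rewrite /= enum_val_setT ii'.
Qed.

(** Index sets compose: [T k] is pushed forward along the enumeration of [S k], which is increasing
    and so keeps positions. *)
Lemma is_subtensor_trans Y X Z :
  is_subtensor Z Y -> is_subtensor Y X -> is_subtensor Z X.
Proof.
move=> [T ->] [S YE]; case: _ / (esym YE) in T *.
pose f k := @enum_val _ (mem (val (S k))).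
have U0 k : (0 < #|f k @: val (T k)|)%N.
  by rewrite card_imset ?(valP (T k)) //; exact: enum_val_inj.
exists (fun k => exist _ (f k @: val (T k)) (U0 k)).
apply: tensor_eq => [k|i i' ii'] /=.
  by rewrite card_imset //; exact: enum_val_inj.
congr tensor_entry; apply: functional_extensionality_dep => k.
apply/esym/(@enum_val_imset _ _ (f k)); [exact: enum_val_homo|by rewrite ii'].
Qed.

(** Properness speaks of cubical tensors only; this is what carries its bound to arbitrary
    dimensions. *)
Lemma cube_extension X n : (forall k, tensor_dim X k <= n)%N ->
  exists2 Y, is_subtensor X Y & forall k, tensor_dim Y k = n.
Proof.
case: X => m m0 d d0 x /= dn.
have n0 : (0 < n)%N by exact: leq_trans (d0 (Ordinal m0)) (dn _).
(* Out-of-range indices are sent to index 0: no zero padding is needed. *)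
pose Y := Tensor m0 (fun _ : 'I_m => n0)
  (fun i => x (fun k => insubd (Ordinal (d0 k)) (val (i k)))).
exists Y => //.
pose f k : 'I_(d k) -> 'I_n := widen_ord (dn k).
have finj k : injective (f k) by move=> i j /(congr1 val) /= /val_inj.
have S0 k : (0 < #|f k @: [set: 'I_(d k)]|)%N.
  by rewrite (card_imset _ (finj k)) cardsT card_ord d0.
exists (fun k => exist _ (f k @: [set: 'I_(d k)]) (S0 k)).
apply: tensor_eq => [k|i i' ii'] /=.
  by rewrite (card_imset _ (finj k)) cardsT card_ord.
congr x; apply: functional_extensionality_dep => k; apply: val_inj => /=.
have ik : (i k < #|[set: 'I_(d k)]|)%N by rewrite cardsT card_ord.
rewrite (@enum_val_imset _ _ (f k) _ (i' k) (Ordinal ik)) //= ?ii' //.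
by rewrite enum_val_setT /= val_insubd ltn_ord.
Qed.

Lemma mode_permutation_sym X Y : mode_permutation X Y -> mode_permutation Y X.
Proof.
case: X => m m0 d d0 x [s [y [yx ->]]] /=.
(* The two dimensions agree only propositionally, hence the cast in the entries. *)
have e k : d (s ((s^-1)%g k)) = d k by rewrite permKV.
exists (s^-1)%g, (fun j => x (fun k => cast_ord (e k) (j k))); split=> /=.
  move: yx => /= yx i; rewrite -yx; congr y; apply: functional_extensionality_dep => k.
  by apply: val_inj; rewrite /= (congr1 (fun k => val (i k)) (permK s k)).
apply: tensor_eq => [k|i i' ii'] //=.
congr x; apply: functional_extensionality_dep => k; apply: val_inj.
by rewrite /= ii'.
Qed.

(** Restriction commutes with permuting modes: mode [k] of [Y] receives the index set of mode [s k]
    of [X]. *)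
Lemma is_subtensor_mode_permutation X Y Z :
  mode_permutation X Y -> is_subtensor Z X ->
  exists2 Z', is_subtensor Z' Y & mode_permutation Z Z'.
Proof.
move=> [s [y [yx ->]]] [S ->].
pose T k : index_set (tensor_dim X (s k)) := S (s k).
set Y' := Tensor _ _ _.
exists (@subtensor R Y' T); first by exists T.
exists s, (fun j => y (fun k => enum_val (j k))); split=> // i /=.
by rewrite -yx.
Qed.

(** * Rank-one tensors through product equations *)

Section RankOne.
Variable X : tensor R.
Implicit Types a i : forall k, 'I_(tensor_dim X k).

(** Taking the new coordinate from a whole multi-index [i] avoids a cast between the index types at
    [k] and [l]. *)
Definition replace_at a i k : forall l, 'I_(tensor_dim X l) :=
  fun l => if l == k then i l else a l.

(** In the product over [k], mode [l] contributes [x l 0 (i l)] once, for [k = l], and [x l 0 (a l)]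
    for every other [k]. *)
Lemma rank_one_prod_replace a i : rank_one X ->
  (tensor_entry X i * tensor_entry X a ^+ (tensor_order X).-1 =
   \prod_k tensor_entry X (replace_at a i k))%R.
Proof.
move=> [x [_ xE]].
under eq_bigr do rewrite xE.
rewrite exchange_big /= !xE -prodrXl -big_split /=.
apply: eq_bigr => l _; rewrite (bigD1 l) //= /replace_at eqxx; congr (_ * _)%R.
rewrite (eq_bigr (fun=> x l 0%R (a l))) => [|k /negPf kl]; last first.
  by rewrite eq_sym kl.
by rewrite prodr_const cardC1 card_ord.
Qed.

(** The vectors are the fibres of [X] through [a], up to scalars; they are nonzero because each
    contains the entry at [a]. *)
Lemma rank_one_of_prod_replace a : tensor_entry X a != 0%R ->
  (forall i, tensor_entry X i * tensor_entry X a ^+ (tensor_order X).-1 =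
     \prod_k tensor_entry X (replace_at a i k))%R -> rank_one X.
Proof.
move=> a0 star; pose c := tensor_entry X a.
pose k0 := Ordinal (tensor_order_gt0 X).
(* Leaving one mode unscaled gives exactly m - 1 factors [c^-1], which cancel the power of [c] in
   the equations. *)
pose w k := (if k == k0 then 1 else c^-1)%R.
have w0 k : w k != 0%R by rewrite /w; case: ifP; rewrite ?oner_eq0 ?invr_eq0.
exists (fun k => \row_j (w k * tensor_entry X (dfwith a j)))%R; split=> [k|i].
  apply/eqP => /rowP/(_ (a k)); rewrite !mxE => /eqP; apply/negP.
  rewrite mulf_neq0 // (_ : dfwith a (a k) = a) //.
  by apply: functional_extensionality_dep => l; case: dfwithP.
under eq_bigr => k _.
  rewrite mxE (_ : dfwith a (i k) = replace_at a i k); first over.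
  apply: functional_extensionality_dep => l; rewrite /replace_at.
  by case: dfwithP => [|l' kl]; rewrite ?eqxx // eq_sym (negPf kl).
rewrite big_split /= -star (bigD1 k0) //= {1}/w eqxx mul1r.
rewrite (eq_bigr (fun=> c^-1)%R) => [|k /negPf kk0]; last by rewrite /w kk0.
rewrite prodr_const cardC1 card_ord exprVn mulrC mulfK //.
by rewrite expf_neq0.
Qed.

End RankOne.

Lemma not_rank_one_subtensor X :
  ~ zero_tensor X -> ~ rank_one X ->
  exists Y, [/\ is_subtensor Y X, forall k, (tensor_dim Y k <= 2)%N,
    ~ zero_tensor Y & ~ rank_one Y].
Proof.
move=> /existsNP[a /eqP a0] nr1.
have [i neq_prod] : exists i,
  (tensor_entry X i * tensor_entry X a ^+ (tensor_order X).-1 <>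
     \prod_k tensor_entry X (replace_at a i k))%R.
  by apply/existsNP => /(rank_one_of_prod_replace a0).
have S0 k : (0 < #|[set a k; i k]|)%N by rewrite cards2.
pose S k : index_set (tensor_dim X k) := exist _ [set a k; i k] (S0 k).
have aS k : a k \in val (S k) by rewrite !inE eqxx.
have iS k : i k \in val (S k) by rewrite !inE eqxx orbT.
(* Positions of [a k] and [i k] within the index set, so that the failing equation can be read in
   the subtensor. *)
pose a' k := enum_rank_in (aS k) (a k).
pose i' k := enum_rank_in (aS k) (i k).
have a'E k : enum_val (a' k) = a k by exact: (enum_rankK_in (aS k) (aS k)).
have i'E k : enum_val (i' k) = i k by exact: (enum_rankK_in (aS k) (iS k)).
have Ya' : tensor_entry (subtensor S) a' = tensor_entry X a.
  exact: (@eq_tensor_entry X (fun k => enum_val (a' k))).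
exists (subtensor S); split; first by exists S.
- by move=> k /=; rewrite cards2; case: (_ != _).
- by move=> /(_ a'); rewrite Ya'; exact/eqP.
- move=> /(@rank_one_prod_replace (subtensor S) a' i'); rewrite Ya'.
  have -> : tensor_entry (subtensor S) i' = tensor_entry X i.
    exact: (@eq_tensor_entry X (fun k => enum_val (i' k))).
  move=> star; apply: neq_prod; rewrite star; apply: eq_bigr => k _ /=.
  pose b l := @enum_val _ (mem (val (S l))) (@replace_at (subtensor S) a' i' k l).
  apply: (@eq_tensor_entry X b) => l; rewrite /b /replace_at.
  by case: (l == k); [exact: i'E|exact: a'E].
Qed.

End Subtensors.

(** * Invertible submatrices of maximal size *)

Section Submatrix.
Local Open Scope ring_scope.
Variable F : fieldType.

(** [maxrankfun] selects independent rows by a function, whereas subtensors need a set; its image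
    works, since every selected row is still a row of the submatrix. *)
Lemma max_rank_rows n p (A : 'M[F]_(n, p)) : exists2 S : {set 'I_n},
  #|S| = \rank A & \rank (rowsub (@enum_val _ (mem S)) A) = \rank A.
Proof.
pose f := maxrankfun A; have finj : injective f by exact: maxrankfun_inj.
exists [set f i | i in 'I_(\rank A)].
  by rewrite card_imset // card_ord.
apply/eqP; rewrite eqn_leq mxrankS ?rowsub_sub //=.
have /eqP {1}<- := maxrowsub_free A.
apply: mxrankS; apply/row_subP => i; rewrite row_rowsub.
have fi : f i \in [set f i | i in 'I_(\rank A)] by exact: imset_f.
rewrite -/f -[f i](enum_rankK_in fi fi) -row_rowsub; exact: row_sub.
Qed.

(** Rows are selected first, then columns as rows of the transpose. *)
Lemma max_rank_submatrix n p (A : 'M[F]_(n, p)) :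
  exists (S : {set 'I_n}) (T : {set 'I_p}), [/\ #|S| = \rank A, #|T| = \rank A &
    \rank (mxsub (@enum_val _ (mem S)) (@enum_val _ (mem T)) A) = \rank A].
Proof.
have [S cS rS] := max_rank_rows A.
have [T cT rT] := max_rank_rows (rowsub (@enum_val _ (mem S)) A)^T.
rewrite mxrank_tr rS in cT rT.
exists S, T; split=> //; rewrite -[RHS]rT -mxrank_tr; congr mxrank.
by apply/matrixP => i j; rewrite !mxE.
Qed.

End Submatrix.

(** * The closure as a maximum, and full rank criteria *)

Section Closure.
Variables (R : realType) (r : tensor R -> nat).
Implicit Types X Y Z : tensor R.

Lemma rank_closure_ge X Y :
  is_subtensor Y X -> full_rank r Y -> (r Y <= rank_closure r X)%N.
Proof.
move=> [S ->] fY.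
(* The maximum ranges over finite functions, while [is_subtensor] provides a plain one. *)
pose S' : {dffun forall k, index_set (tensor_dim X k)} := [ffun k => S k].
have S'E : S' = S :> (forall k, index_set (tensor_dim X k)).
  by apply: functional_extensionality_dep => k; rewrite ffunE.
pose F (T : {dffun forall k, index_set (tensor_dim X k)}) := r (subtensor T).
rewrite -S'E in fY *; apply: (@leq_bigmax_cond _ _ F S'); exact/asboolP.
Qed.

Lemma rank_closure_le X n :
  (forall Y, is_subtensor Y X -> full_rank r Y -> (r Y <= n)%N) ->
  (rank_closure r X <= n)%N.
Proof.
move=> le_n; apply/bigmax_leqP => S /asboolP fS.
by apply: le_n => //; exists S.
Qed.

(** Positivity excludes the default value 0 of an empty maximum. If the value were not attained, its
    predecessor would be a bound. *)
Lemma rank_closure_attained X : (0 < rank_closure r X)%N ->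
  exists Y, [/\ is_subtensor Y X, full_rank r Y & rank_closure r X = r Y].
Proof.
move=> rX0; apply: contrapT => nY.
suff : (rank_closure r X <= (rank_closure r X).-1)%N.
  by rewrite -ltnS prednK // ltnn.
apply: rank_closure_le => Y YX fY; rewrite -ltnS prednK // ltn_neqAle.
rewrite rank_closure_ge // andbT; apply/eqP => rY.
by apply: nY; exists Y.
Qed.

Lemma rank_closure_subtensor X Y :
  is_subtensor Y X -> (rank_closure r Y <= rank_closure r X)%N.
Proof.
move=> YX; apply: rank_closure_le => Z ZY.
by apply: rank_closure_ge; exact: is_subtensor_trans ZY YX.
Qed.

Hypothesis hr : proper_tensor_rank_function r.
Let rk : tensor_rank_function r := hr.1.

Lemma rank_closure_le_rank X : (rank_closure r X <= r X)%N.
Proof. by apply: rank_closure_le => Y /(rank_subtensor rk). Qed.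

Lemma rank_closure_full X : full_rank r X -> rank_closure r X = r X.
Proof.
move=> fX; apply/eqP; rewrite eqn_leq rank_closure_le_rank /=.
by apply: rank_closure_ge => //; exact: is_subtensor_refl.
Qed.

Lemma rank_le_max_dim X n : (forall k, tensor_dim X k <= n)%N -> (r X <= n)%N.
Proof.
move=> /cube_extension[Y XY Yn].
exact: leq_trans (rank_subtensor rk XY) (hr.2 Y n Yn).
Qed.

(** In this form full rank depends only on the dimensions and the value of [r], so it transfers
    under scaling and mode permutation. *)
Lemma full_rankE X : full_rank r X <-> r X = 0%N \/ exists p, r X = tensor_dim X p.
Proof.
by split=> -[/(rank_eq0 rk)|]; [left|right|left|right].
Qed.

(** The value [r X] is at most the largest dimension, which is at most [n], so all three agree. *)
Lemma full_rank_max_dim X n :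
  (forall k, tensor_dim X k <= n)%N -> (n <= r X)%N -> full_rank r X.
Proof.
move=> dn nr; right.
have /(eq_bigmax (tensor_dim X))[p pE] : (0 < #|'I_(tensor_order X)|)%N.
  by rewrite card_ord tensor_order_gt0.
exists p; apply/eqP; rewrite eqn_leq -{1}pE rank_le_max_dim => [/=|k].
  exact: leq_trans (dn p) nr.
exact: leq_bigmax.
Qed.

(** * The tensor rank axioms for the closure *)

Lemma rank_closure_eq0 X : rank_closure r X = 0%N <-> zero_tensor X.
Proof.
split=> [rX|X0]; last first.
  by rewrite rank_closure_full; [exact/(rank_eq0 rk)|left].
apply: contrapT => /existsNP[a aN0].
have S0 k : (0 < #|[set a k]|)%N by rewrite cards1.
pose S k : index_set (tensor_dim X k) := exist _ [set a k] (S0 k).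
have r0 : (1 <= r (subtensor S))%N.
  rewrite lt0n; apply/eqP => /(rank_eq0 rk)/(_ (fun k => Ordinal (S0 k))) /=.
  move=> E; apply: aN0; rewrite -E; apply: eq_tensor_entry => k; apply/eqP.
  by rewrite eq_sym -in_set1 enum_valP.
suff : (1 <= rank_closure r X)%N by rewrite rX.
apply: (leq_trans r0); apply: rank_closure_ge; first by exists S.
by apply: (@full_rank_max_dim _ 1) => // k /=; rewrite cards1.
Qed.

Lemma rank_closure_eq1 X : rank_closure r X = 1%N <-> rank_one X.
Proof.
split=> [rX|X1]; last first.
  have rX : r X = 1%N by exact/(rank_eq1 rk).
  apply/eqP; rewrite eqn_leq -{1}rX rank_closure_le_rank lt0n.
  by apply/eqP => /rank_closure_eq0/(rank_eq0 rk); rewrite rX.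
apply: contrapT => nX1.
have nX0 : ~ zero_tensor X by move/rank_closure_eq0; rewrite rX.
have [Y [YX dY nY0 nY1]] := not_rank_one_subtensor nX0 nX1.
have rY : (2 <= r Y)%N.
  rewrite ltn_neqAle lt0n eq_sym; apply/andP; split; apply/eqP.
    by move/(rank_eq1 rk).
  by move/(rank_eq0 rk).
have := leq_trans rY (rank_closure_ge YX (full_rank_max_dim dY rY)).
by rewrite rX.
Qed.

Lemma rank_closure_matrix X (k1 k2 : 'I_(tensor_order X))
    (A : 'M[R]_(tensor_dim X k1, tensor_dim X k2)) :
  nat_of_ord k1 = 0%N -> nat_of_ord k2 = 1%N ->
  (forall k : 'I_(tensor_order X), (2 <= k)%N -> tensor_dim X k = 1%N) ->
  (forall i, tensor_entry X i = A (i k1) (i k2)) ->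
  rank_closure r X = (\rank A)%R.
Proof.
move=> k1E k2E dX XA; have rX := rank_matrix rk k1E k2E dX XA.
apply/eqP; rewrite eqn_leq -{1}rX rank_closure_le_rank /=.
(* Rank 0 is set apart because index sets must be nonempty. *)
have [->//|rA0] := posnP (\rank A)%R.
have [A1 [A2 [c1 c2 rA12]]] := max_rank_submatrix A.
have A10 : (0 < #|A1|)%N by rewrite c1.
have A20 : (0 < #|A2|)%N by rewrite c2.
pose full k := full_set (tensor_dim_gt0 X k).
have k12 : k1 != k2 by rewrite -val_eqE /= k1E k2E.
(* All other modes keep their full index set, of size 1, so the subtensor is again of matrix
   shape. *)
pose S2 := dfwith full (exist _ A2 A20 : index_set (tensor_dim X k2)).
pose S := dfwith S2 (exist _ A1 A10 : index_set (tensor_dim X k1)).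
have Sk1 : S k1 = exist _ A1 A10 by rewrite /S dfwith_in.
have Sk2 : S k2 = exist _ A2 A20 by rewrite /S dfwith_out // /S2 dfwith_in.
have dS (k : 'I_(tensor_order X)) : (2 <= k)%N -> #|val (S k)| = 1%N.
  move=> k2'; rewrite /S dfwith_out ?/S2 ?dfwith_out /=.
  - by rewrite cardsT card_ord dX.
  - by rewrite -val_eqE /= k2E; case: (val k) k2' => [|[]].
  - by rewrite -val_eqE /= k1E; case: (val k) k2'.
pose B := mxsub (@enum_val _ (mem (val (S k1)))) (@enum_val _ (mem (val (S k2)))) A.
have rB : (\rank B = \rank A)%R by rewrite /B Sk1 Sk2.
have rS : r (subtensor S) = (\rank A)%R.
  rewrite -rB; apply: (@rank_matrix _ _ rk (subtensor S) k1 k2 B) => // i.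
  by rewrite mxE /= XA.
rewrite -rS; apply: rank_closure_ge; first by exists S.
(* The selected submatrix is invertible: its rank is its number of rows. *)
by right; exists k1; rewrite rS /= Sk1.
Qed.

Lemma rank_closure_scale (a : R) X :
  a != 0%R -> rank_closure r (scale_tensor a X) = rank_closure r X.
Proof.
(* A subtensor of the scaled tensor is the scaled subtensor by conversion, so both maxima run over
   the same index sets. *)
move=> a0; have rE S : r (subtensor (X := scale_tensor a X) S) =
    r (subtensor (X := X) S) by exact: (@rank_scale _ _ rk a (@subtensor R X S) a0).
apply: eq_big => S; last by rewrite rE.
by apply: asbool_equiv_eq; rewrite !full_rankE rE.
Qed.

Lemma full_rank_mode_permutation X Y :
  mode_permutation X Y -> full_rank r X -> full_rank r Y.
Proof.
move=> XY; rewrite !full_rankE (rank_mode_permutation rk XY).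
move=> [->|[p ->]]; [by left|right].
case: XY => s [y [_ ->]].
by exists ((s^-1)%g p); rewrite /= permKV.
Qed.

Lemma rank_closure_mode_permutation X Y :
  mode_permutation X Y -> rank_closure r Y = rank_closure r X.
Proof.
(* One inequality suffices, mode permutation being symmetric. *)
have le X' Y' : mode_permutation X' Y' ->
    (rank_closure r X' <= rank_closure r Y')%N.
  move=> XY; apply: rank_closure_le => Z ZX fZ.
  have [Z' Z'Y ZZ'] := is_subtensor_mode_permutation XY ZX.
  rewrite -(rank_mode_permutation rk ZZ'); apply: rank_closure_ge => //.
  exact: full_rank_mode_permutation ZZ' fZ.
by move=> XY; apply/eqP; rewrite eqn_leq !le //; exact: mode_permutation_sym.
Qed.

Lemma rank_closure_proper : proper_tensor_rank_function (rank_closure r).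
Proof.
split; last first.
  by move=> X n dX; exact: leq_trans (rank_closure_le_rank X) (hr.2 X n dX).
split.
- exact: rank_closure_eq0.
- exact: rank_closure_eq1.
- move=> m n m0 n0 m2; have rI := rank_identity rk m0 n0 m2.
  by rewrite rank_closure_full //; right; exists (Ordinal m0).
- exact: rank_closure_matrix.
- exact: rank_closure_scale.
- exact: rank_closure_mode_permutation.
- exact: rank_closure_subtensor.
Qed.

(** * The max-full-rank-subtensor property *)

Lemma max_full_rank_subtensor_propertyE :
  max_full_rank_subtensor_property r <-> rank_closure r =1 r.
Proof.
split=> [prop X|E X].
  have [Y [[YX fY _] rXY]] := prop X.
  by apply/eqP; rewrite eqn_leq rank_closure_le_rank rXY rank_closure_ge.
(* If the closure vanishes, [X] is zero and serves as its own maximum full rank subtensor; otherwise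
   the maximum is attained. *)
have [rX0|rX0] := posnP (rank_closure r X).
  exists X; split=> //; split; first exact: is_subtensor_refl.
    by left; exact/rank_closure_eq0.
  by move=> Z /(rank_subtensor rk).
have [Y [YX fY rY]] := rank_closure_attained rX0.
exists Y; split; last by rewrite -E.
by split=> // Z ZX fZ; rewrite -rY rank_closure_ge.
Qed.

End Closure.

Theorem theorem5p2 (R : realType) (r : tensor R -> nat)
    (hr : proper_tensor_rank_function r) :
  [/\ proper_tensor_rank_function (rank_closure r),
      forall X : tensor R, rank_closure r X <= r X &
      max_full_rank_subtensor_property r <-> rank_closure r =1 r].
Proof.
split.
- exact: rank_closure_proper.
- exact: rank_closure_le_rank.
- exact: max_full_rank_subtensor_propertyE.
Qed.
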